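(* Let $r,n$ be positive integers and let $\mathbb{F}_2[\mathbf{x}]$ be the polynomial ring over $\mathbb{F}_2$ in the variables $\mathbf{x}=\{x_{ijk}: i,j\in[r], k\in[n]\}$. Let $I_{r,n}$ be the ideal generated by the polynomials $x_{ijk}(x_{ijk}-1)$, $x_{ijk}x_{i'jk}$, $x_{ijk}x_{ij'k}$, $x_{ijk}x_{ijk'}$ for all $i,j\in[r]$, $k\in[n]$, $i'\in\{i+1,\ldots,r\}$, $j'\in\{j+1,\ldots,r\}$, $k'\in\{k+1,\ldots,n\}$, together with the polynomials $x_{ijp}\,x_{klp}\,x_{jiq}\,x_{lkq}$ for all $i,j,k,l\in[r]$ and $p,q\in[n]$ with $(i,j)\neq(k,l)$. Then $I_{r,n}$ is zero-dimensional, and the map sending $P=(p_{ij})\in\mathcal{SOR}_{r,n}$ to the point of $\mathbb{F}_2^{r^2n}$ with $x_{ijk}=1$ if $p_{ij}=k$ and $x_{ijk}=0$ otherwise is a bijection from $\mathcal{SOR}_{r,n}$ onto the set of common zeros of $I_{r,n}$. Moreover, $|\mathcal{SOR}_{r,n}|=\dim_{\mathbb{F}_2}(\mathbb{F}_2[\mathbf{x}]/I_{r,n})$ and, for every $m\geq 0$, $|\mathcal{SOR}_{r,n:m}|=\mathrm{HF}_{\mathbb{F}_2[\mathbf{x}]/I_{r,n}}(m)$.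
   Context: An $r\times s$ partial Latin rectangle based on $[n]=\{1,\ldots,n\}$ is an $r\times s$ array in which each cell is either empty or contains a symbol of $[n]$, such that each symbol occurs at most once in each row and in each column; its size is its number of filled cells. Two such arrays $P=(p_{ij}),Q=(q_{ij})$ of the same dimensions are orthogonal if whenever $p_{ij}=p_{i'j'}\in[n]$ for cells $(i,j)\neq(i',j')$, the entries $q_{ij}$ and $q_{i'j'}$ are not the same symbol of $[n]$. An $r\times r$ partial Latin rectangle is self-orthogonal if it is orthogonal to its transpose. $\mathcal{SOR}_{r,n}$ is the set of self-orthogonal $r\times r$ partial Latin rectangles based on $[n]$ and $\mathcal{SOR}_{r,n:m}$ its subset of those of size $m$. For an ideal $I$ of a polynomial ring $R$ and the lexicographic term order, a standard monomial of $I$ is a monomial not in the initial ideal of $I$; $\mathrm{HF}_{R/I}(d)$ denotes the number of standard monomials of $I$ of degree $d$. *)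

(* Defs.v *)
From mathcomp Require Import all_boot all_order all_algebra perm.
From mathcomp Require Import boolp classical_sets functions.
From mathcomp Require Import mpoly.

Set Implicit Arguments.
Unset Strict Implicit.
Unset Printing Implicit Defensive.

Import GRing.Theory.
Local Open Scope ring_scope.

(* An array has entries in [option 'I_n]: [None] is an empty cell, and
   rows, columns and symbols are numbered from 0. *)

Definition partial_latin r s n (P : 'M[option 'I_n]_(r, s)) : bool :=
  [forall i, forall j, forall j',
     (j != j') && (P i j != None) ==> (P i j != P i j')] &&
  [forall j, forall i, forall i',
     (i != i') && (P i j != None) ==> (P i j != P i' j)].

Definition psize r s n (P : 'M[option 'I_n]_(r, s)) : nat :=
  #|[set c : 'I_r * 'I_s | P c.1 c.2 != None]|.

Definition orthogonal r s n (P Q : 'M[option 'I_n]_(r, s)) : bool :=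
  [forall c : 'I_r * 'I_s, forall c' : 'I_r * 'I_s,
     [&& c != c', P c.1 c.2 != None & P c.1 c.2 == P c'.1 c'.2] ==>
     ~~ ((Q c.1 c.2 != None) && (Q c.1 c.2 == Q c'.1 c'.2))].

Definition SOR r n : {set 'M[option 'I_n]_r} :=
  [set P | partial_latin P && orthogonal P P^T].

Definition SORm r n m : {set 'M[option 'I_n]_r} :=
  [set P in SOR r n | psize P == m].

Section Ideals.
Variable R : comNzRingType.

Definition ideal_gen (G : R -> Prop) : {pred R} :=
  fun p => `[< exists (m : nat) (c g : 'I_m -> R),
                 (forall i, G (g i)) /\ p = \sum_i c i * g i >].

(* [idealr_closed] includes properness. *)
Definition maximal_ideal (M : {pred R}) : Prop :=
  idealr_closed M /\
  forall J : {pred R}, idealr_closed J -> {subset M <= J} -> {subset J <= M}.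

(* R/I has Krull dimension 0: it is nonzero and its primes are maximal. *)
Definition zero_dimensional (I : {pred R}) : Prop :=
  idealr_closed I /\
  forall Q : {pred R}, idealr_closed Q -> prime_idealr_closed Q ->
    {subset I <= Q} -> maximal_ideal Q.

End Ideals.

(* The classes modulo the subspace I of d vectors form a basis of V/I. *)
Definition has_quotient_dim (K : fieldType) (V : lmodType K) (I : {pred V})
    (d : nat) : Prop :=
  exists b : 'I_d -> V, forall v : V,
    exists! c : {ffun 'I_d -> K}, v - \sum_i c i *: b i \in I.

Section Lex.
Variables (N : nat) (K : fieldType) (s : {perm 'I_N}).

(* Lexicographic order in which the variable 'X_a has rank s a, the variable
   of rank 0 being the largest. *)
Definition lexlt (m1 m2 : 'X_{1..N}) : bool :=
  [exists a, [forall a', (s a' < s a)%N ==> (m1 a' == m2 a')]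
             && (m1 a < m2 a)%N].

Definition is_lex_lead (p : {mpoly K[N]}) (m : 'X_{1..N}) : Prop :=
  m \in msupp p /\
  forall m', m' \in msupp p -> m' != m -> lexlt m' m.

Definition initial_ideal (I : {pred {mpoly K[N]}}) : {pred {mpoly K[N]}} :=
  ideal_gen (fun q => exists p m, [/\ p \in I, is_lex_lead p m & q = 'X_[m]]).

Definition standard_monomial (I : {pred {mpoly K[N]}}) (m : 'X_{1..N}) : bool :=
  'X_[m] \notin initial_ideal I.

(* HF_{K[x]/I}(d); the monomials of degree at most d form a finite type. *)
Definition HF (I : {pred {mpoly K[N]}}) (d : nat) : nat :=
  #|[set m : 'X_{1..N < d.+1} | (mdeg m == d) && standard_monomial I m]|.

End Lex.

Section SelfOrthogonalIdeal.
Variables r n : nat.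

Definition vidx : finType := ('I_r * 'I_r * 'I_n)%type.

Definition nvars : nat := #|vidx|.

Definition x (i j : 'I_r) (k : 'I_n) : {mpoly 'F_2[nvars]} :=
  'X_(enum_rank ((i, j, k) : vidx)).

Inductive so_generator : {mpoly 'F_2[nvars]} -> Prop :=
| SoBool i j k : so_generator (x i j k * (x i j k - 1))
| SoCol (i i' j : 'I_r) k : (i < i')%N ->
    so_generator (x i j k * x i' j k)
| SoRow (i j j' : 'I_r) k : (j < j')%N ->
    so_generator (x i j k * x i j' k)
| SoCell i j (k k' : 'I_n) : (k < k')%N ->
    so_generator (x i j k * x i j k')
| SoOrth (i j k l : 'I_r) (p q : 'I_n) : (i, j) != (k, l) ->
    so_generator (x i j p * x k l p * x j i q * x l k q).

Definition so_ideal : {pred {mpoly 'F_2[nvars]}} := ideal_gen so_generator.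

(* Points of affine space are indexed by triples rather than by 'I_nvars. *)
Definition common_zeros (I : {pred {mpoly 'F_2[nvars]}}) :
    set {ffun vidx -> 'F_2} :=
  fun y => forall p, p \in I -> p.@[fun a => y (enum_val a)] = 0.

Definition point_of (P : 'M[option 'I_n]_r) : {ffun vidx -> 'F_2} :=
  [ffun t : vidx => if P t.1.1 t.1.2 == Some t.2 then 1 else 0].

End SelfOrthogonalIdeal.

Arguments so_ideal : clear implicits.

(* Main.v *)
(** Modulo the polynomials [x(x - 1)] every monomial is congruent to the
    squarefree monomial with the same support, so [I] is governed by the
    simplicial complex of the sets [A] of variables that contain the support of
    no monomial generator; these are the encodings of the self-orthogonal
    partial Latin squares. A polynomial vanishing at the indicator of every
    face has, by Moebius inversion over the complex, zero normal form, hence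
    [I] is the vanishing ideal of these points. The squarefree monomials of
    faces are therefore a basis of the quotient, and they are the standard
    monomials for every lexicographic order, because replacing a monomial by
    its squarefree support never increases it. The vanishing ideal contains
    [p(p - 1)] for all [p], so that primes above it are maximal. *)

Require Import Defs.
From mathcomp Require Import all_boot all_order all_algebra perm.
From mathcomp Require Import boolp classical_sets functions.
From mathcomp Require Import mpoly.

Set Implicit Arguments.
Unset Strict Implicit.
Unset Printing Implicit Defensive.

Import GRing.Theory.
Local Open Scope ring_scope.

(** * Closure properties of generated ideals *)

Section IdealGen.
Variables (R : comNzRingType) (G : R -> Prop).

Lemma mem_ideal_gen p :
  p \in ideal_gen G <-> exists (m : nat) (c g : 'I_m -> R),
    (forall i, G (g i)) /\ p = \sum_i c i * g i.
Proof. by rewrite unfold_in; split=> [/asboolP|?]; last exact/asboolP. Qed.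

Lemma ideal_gen_sub g : G g -> g \in ideal_gen G.
Proof.
move=> Gg; apply/mem_ideal_gen; exists 1%N, (fun=> 1), (fun=> g).
by split=> //; rewrite big_ord1 mul1r.
Qed.

Lemma ideal_gen0 : 0 \in ideal_gen G.
Proof.
apply/mem_ideal_gen; exists 0%N, (fun=> 0), (fun=> 0).
by rewrite big_ord0; split=> // -[].
Qed.

Lemma ideal_genMD a : {in ideal_gen G &, forall u v, a * u + v \in ideal_gen G}.
Proof.
move=> u v /mem_ideal_gen[m1 [c1 [g1 [G1 ->]]]].
move=> /mem_ideal_gen[m2 [c2 [g2 [G2 ->]]]].
apply/mem_ideal_gen; exists (m1 + m2)%N.
exists (fun i => match fintype.split i with inl j => a * c1 j | inr j => c2 j end).
exists (fun i => match fintype.split i with inl j => g1 j | inr j => g2 j end).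
split=> [i|]; first by case: (fintype.split i).
rewrite big_split_ord /= mulr_sumr; congr (_ + _); apply: eq_bigr => i _.
  by rewrite (unsplitK (inl i)) mulrA.
by rewrite (unsplitK (inr i)).
Qed.

Lemma ideal_genD : {in ideal_gen G &, forall u v, u + v \in ideal_gen G}.
Proof. by move=> u v Iu Iv; rewrite -[u]mul1r ideal_genMD. Qed.

Lemma ideal_genMl a : {in ideal_gen G, forall u, a * u \in ideal_gen G}.
Proof. by move=> u Iu; rewrite -[a * u]addr0 ideal_genMD // ideal_gen0. Qed.

Lemma ideal_genN : {in ideal_gen G, forall u, - u \in ideal_gen G}.
Proof. by move=> u Iu; rewrite -mulN1r ideal_genMl. Qed.

Lemma ideal_genB : {in ideal_gen G &, forall u v, u - v \in ideal_gen G}.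
Proof. by move=> u v Iu Iv; rewrite ideal_genD // ideal_genN. Qed.

Lemma ideal_gen_sum (T : eqType) (s : seq T) (F : T -> R) :
  (forall i, i \in s -> F i \in ideal_gen G) ->
  \sum_(i <- s) F i \in ideal_gen G.
Proof.
move=> IF; rewrite big_seq; elim/big_ind: _ => //; first exact: ideal_gen0.
by move=> u v; apply: ideal_genD.
Qed.

(** Lets a monomial be reduced modulo the ideal one variable at a time. *)
Lemma ideal_gen_prodB (T : Type) (s : seq T) (E F : T -> R) :
  (forall i, E i - F i \in ideal_gen G) ->
  \prod_(i <- s) E i - \prod_(i <- s) F i \in ideal_gen G.
Proof.
move=> IEF; elim/big_ind2: _ => [|u1 u2 v1 v2 Iu Iv|i _]; last exact: IEF.
  by rewrite subrr ideal_gen0.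
rewrite -(subrKA (u2 * v1)) -mulrBr -mulrBl [X in _ + X]mulrC.
by rewrite ideal_genD ?ideal_genMl.
Qed.

Lemma ideal_gen_rmorph0 (S : nzRingType) (f : {rmorphism R -> S}) :
  (forall g, G g -> f g = 0) -> {in ideal_gen G, forall p, f p = 0}.
Proof.
move=> f0 p /mem_ideal_gen[m [c [g [Gg ->]]]].
by rewrite rmorph_sum big1 // => i _; rewrite rmorphM (f0 _ (Gg i)) mulr0.
Qed.

End IdealGen.

(** * Ideals generated by Boolean polynomials and monomials over a field *)

Section SquarefreeBooleanIdeal.
Variables (N : nat) (K : fieldType) (G : {mpoly K[N]} -> Prop).
Implicit Types (A B : {set 'I_N}) (m : 'X_{1..N}) (p : {mpoly K[N]}).

Definition ind A : 'I_N -> K := fun a => (a \in A)%:R.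

Definition mnm_supp m : {set 'I_N} := [set a | m a != 0%N].

(** The 0/1 common zeros of the generators, encoded as sets; [facesP] recovers the simplicial
    complex. *)
Definition faces : {set {set 'I_N}} :=
  [set A | `[< forall g, G g -> g.@[ind A] = 0 >]].

(** The coefficient on [B] once every monomial is collapsed to its squarefree support. *)
Definition supp_coeff p B : K :=
  \sum_(m <- msupp p | mnm_supp m == B) p@_m.

Hypothesis G_bool : forall a, G ('X_a * ('X_a - 1)).
Hypothesis G_shape : forall g, G g ->
  (exists a, g = 'X_a * ('X_a - 1)) \/ (exists m, g = 'X_[m]).

Notation I := (ideal_gen G).

Lemma mnm_supp_mesym1 A : mnm_supp (mesym1 A) = A.
Proof. by apply/setP=> a; rewrite finset.inE mnmE; case: (a \in A). Qed.

Lemma mesym1_supp_le m : (mesym1 (mnm_supp m) <= m)%MM.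
Proof. by apply/mnm_lepP=> a; rewrite mnmE finset.inE; case: (m a). Qed.

Lemma meval_ind A m : 'X_[m].@[ind A] = (mnm_supp m \subset A)%:R.
Proof.
rewrite mevalX; case: (boolP (_ \subset _)) => [/fintype.subsetP sA|/fintype.subsetPn[a]].
  rewrite big1 // => a _; rewrite /ind; have [->|m0] := eqVneq (m a) 0%N.
    by rewrite expr0.
  by rewrite sA ?expr1n // finset.inE.
by rewrite finset.inE => ma aA; rewrite (bigD1 a) //= /ind (negPf aA) expr0n (negPf ma)
  mul0r.
Qed.

(** A monomial is 1 at [ind A] if its support lies in [A] and 0 otherwise, so evaluation is the zeta
    transform of [supp_coeff p]. *)
Lemma meval_ind_supp_coeff A p :
  p.@[ind A] = \sum_(B : {set 'I_N} | B \subset A) supp_coeff p B.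
Proof.
rewrite {1}[p]mpolyE raddf_sum /=.
rewrite (partition_big mnm_supp predT) // big_mkcond [RHS]big_mkcond /=.
apply: eq_bigr => B _; case: ifP => BA.
  by apply: eq_bigr => m /eqP Em; rewrite mevalZ meval_ind Em BA mulr1.
by rewrite big1 // => m /eqP Em; rewrite mevalZ meval_ind Em BA mulr0.
Qed.

Lemma ind_bool A a : ('X_a * ('X_a - 1)).@[ind A] = 0 :> K.
Proof.
rewrite mevalM mevalB meval1 mevalXU /ind.
by case: (a \in A); rewrite ?subrr ?mulr0 ?mul0r.
Qed.

Lemma facesP A :
  reflect (forall m, G 'X_[m] -> ~~ (mnm_supp m \subset A)) (A \in faces).
Proof.
rewrite finset.in_set; apply: (iffP (asboolP _)) => [G0 m /G0 /eqP|sub g Gg].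
  by rewrite meval_ind; case: (_ \subset _); rewrite ?oner_eq0.
case: (G_shape Gg) => [[a ->]|[m Em]]; first exact: ind_bool.
by rewrite Em meval_ind (negPf (sub _ _)) // -Em.
Qed.

Lemma faces_sub A B : B \subset A -> A \in faces -> B \in faces.
Proof.
move=> BA /facesP fA; apply/facesP=> m /fA; apply: contra => mB.
exact: fintype.subset_trans mB BA.
Qed.

(* Moebius inversion over the down-closed family of faces. *)
Lemma faces_triangular (c : {set 'I_N} -> K) :
  (forall A, A \in faces -> \sum_(B : {set 'I_N} | B \subset A) c B = 0) ->
  forall A, A \in faces -> c A = 0.
Proof.
move=> c0 A; have [k] := ubnP #|A|; elim: k A => // k IHk A leAk fA.
have := c0 A fA; rewrite (bigD1 A) //= big1 ?addr0 // => B.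
rewrite andbC -finset.properEneq => pBA; apply: IHk; last first.
  exact: faces_sub (proper_sub pBA) fA.
exact: leq_trans (proper_card pBA) _.
Qed.

Lemma ideal_vanish p A : p \in I -> A \in faces -> p.@[ind A] = 0.
Proof.
move=> Ip; rewrite finset.in_set => /asboolP G0.
exact: (@ideal_gen_rmorph0 _ G K (meval (ind A))) Ip.
Qed.

Lemma ideal_supp_coeff p A : p \in I -> A \in faces -> supp_coeff p A = 0.
Proof.
move=> Ip; apply: (faces_triangular (c := supp_coeff p)) => {}A fA.
by rewrite -meval_ind_supp_coeff ideal_vanish.
Qed.

Lemma mpolyX_supp m : 'X_[m] - 'X_[mesym1 (mnm_supp m)] \in I.
Proof.
rewrite [X in X - _]mpolyXE_id [X in _ - X]mpolyXE_id.
apply: ideal_gen_prodB => a; rewrite mnmE finset.inE; case: (m a) => [|k] /=.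
  by rewrite subrr ideal_gen0.
rewrite expr1; elim: k => [|k IHk]; first by rewrite expr1 subrr ideal_gen0.
(* With X for ['X_a]: X^(k+2) - X = X (X^(k+1) - X) + (X^2 - X). *)
rewrite exprS -(subrKA ('X_a * 'X_a)) -mulrBr ideal_genD ?ideal_genMl //.
by apply: ideal_gen_sub; rewrite -[X in _ - X]mulr1 -mulrBr.
Qed.

(** Some generator ['X_[m]] has its support inside [A]; its product with ['X_[mesym1 A]] lies in the
    ideal and has support [A], hence is congruent to ['X_[mesym1 A]]. *)
Lemma mpolyX_nonface A : A \notin faces -> 'X_[mesym1 A] \in I.
Proof.
rewrite finset.in_set => /asboolPn /existsNP[g] /not_implyP[Gg].
case: (G_shape Gg) => [[a ->]|[m Em]]; first by rewrite ind_bool.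
rewrite Em meval_ind; case: (boolP (_ \subset _)) => // mA _.
have := mpolyX_supp (m + mesym1 A).
have -> : mnm_supp (m + mesym1 A) = A.
  apply/setP=> a; move/fintype.subsetP/(_ a): mA; rewrite !finset.inE mnmDE mnmE addn_eq0.
  by case: (a \in A); rewrite ?andbF ?andbT //; case: (m a) => // k /(_ isT).
move/ideal_genB; rewrite mpolyXD mulrC => /(_ ('X_[mesym1 A] * 'X_[m])).
rewrite addrAC subrr add0r => /(_ _)/ideal_genN; rewrite opprK; apply.
by rewrite ideal_genMl // ideal_gen_sub // -Em.
Qed.

Lemma supp_coeff_normal_form p :
  p - \sum_(B in faces) supp_coeff p B *: 'X_[mesym1 B] \in I.
Proof.
(* Regrouping by monomials of [p] reduces the claim to one monomial at a time. *)
have -> : \sum_(B in faces) supp_coeff p B *: 'X_[mesym1 B] =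
  \sum_(m <- msupp p)
    p@_m *: (if mnm_supp m \in faces then 'X_[mesym1 (mnm_supp m)] else 0).
  rewrite (partition_big mnm_supp predT) // big_mkcond; apply: eq_bigr => B _.
  case: ifP => fB.
    by rewrite scaler_suml; apply: eq_bigr => m /eqP->; rewrite fB.
  by rewrite big1 // => m /eqP->; rewrite fB scaler0.
rewrite {1}[p]mpolyE -sumrB; apply: ideal_gen_sum => m _.
rewrite -scalerBr -mul_mpolyC ideal_genMl //.
case: (boolP (_ \in faces)) => [_|nf]; first exact: mpolyX_supp.
by rewrite subr0 -[X in X \in _](subrK 'X_[mesym1 (mnm_supp m)])
  ideal_genD ?mpolyX_supp ?mpolyX_nonface.
Qed.

Lemma vanish_ideal p :
  (forall A, A \in faces -> p.@[ind A] = 0) -> p \in I.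
Proof.
move=> p0; have := supp_coeff_normal_form p.
rewrite big1 ?subr0 // => B fB.
rewrite (faces_triangular (c := supp_coeff p)) ?scale0r //.
by move=> A fA; rewrite -meval_ind_supp_coeff p0.
Qed.

(** The normal form gives existence; uniqueness is Moebius inversion applied to the difference of
    two coefficient families. *)
Lemma faces_quotient_dim : has_quotient_dim I #|faces|.
Proof.
exists (fun i => 'X_[mesym1 (enum_val i)]) => v.
have sumE (c : {set 'I_N} -> K) :
  \sum_(i < #|faces|) c (enum_val i) *: 'X_[mesym1 (enum_val i)]
    = \sum_(B in faces) c B *: ('X_[mesym1 B] : {mpoly K[N]}).
  by rewrite [RHS]big_enum_val.
exists [ffun i => supp_coeff v (enum_val i)]; split.
  under eq_bigr do rewrite ffunE.
  by rewrite (sumE (supp_coeff v)) supp_coeff_normal_form.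
move=> c Ic; apply/ffunP => i; rewrite ffunE.
apply/eqP; rewrite -subr_eq0; apply/eqP.
(* Extends the coordinates [c] to all sets, with value 0 off the faces. *)
pose e (B : {set 'I_N}) := \sum_(j < #|faces| | enum_val j == B) c j.
have eE j : e (enum_val j) = c j.
  rewrite /e (eq_bigl (pred1 j)) ?big_pred1_eq // => j'.
  by rewrite /= (inj_eq enum_val_inj).
rewrite -eE; apply: (faces_triangular (c := fun B => supp_coeff v B - e B));
  last exact: enum_valP.
move=> A fA; rewrite sumrB -meval_ind_supp_coeff.
have := ideal_vanish Ic fA.
rewrite mevalB (raddf_sum (meval (ind A))) /=.
under eq_bigr do rewrite mevalZ meval_ind mnm_supp_mesym1 -eE.
have <- : \sum_(B in faces) e B * (B \subset A)%:R
  = \sum_(j < #|faces|) e (enum_val j) * (enum_val j \subset A)%:R.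
  by rewrite big_enum_val.
move=> v0; rewrite -[RHS]v0; congr (_ - _); rewrite big_mkcond [RHS]big_mkcond; apply: eq_bigr => B _.
(* Subsets of the face [A] are faces, so summing over faces only loses no term. *)
case: ifP => BA; first by rewrite (faces_sub BA fA) mulr1.
by rewrite mulr0; case: ifP.
Qed.

(** * Standard monomials for lexicographic orders *)

Section Lex.
Variable s : {perm 'I_N}.

(** Otherwise the monomial is a multiple of the leading monomial [m] of some [p] in the ideal. Then
    [m] is squarefree and its support is a face, so [supp_coeff p] vanishes there. Any other
    monomial of [p] with that support is a multiple of [m], hence not lexicographically smaller; so
    only [m] contributes, and its coefficient is nonzero. *)
Lemma standard_monomial_face A : A \in faces -> standard_monomial s I (mesym1 A).
Proof.
move=> fA; apply/negP => /mem_ideal_gen[k [c [g [lead_g Em]]]].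
have /existsP[i ci0] : [exists i, (c i * g i)@_(mesym1 A) != 0].
  apply/existsPn => ci0; have := mcoeffX K (mesym1 A) (mesym1 A).
  rewrite eqxx Em raddf_sum /= big1 => [/eqP|i _].
    by rewrite eq_sym oner_eq0.
  by apply/eqP; rewrite -[_ == _]negbK.
have [p [m [Ip [mp lead_m] Eg]]] := lead_g i.
move: ci0; rewrite Eg -mcoeff_msupp (perm_mem (msuppMX _ _)) => /mapP[m' _ EA].
have mA : mnm_supp m \subset A.
  apply/fintype.subsetP=> a; rewrite finset.inE; apply: contraNT => aA.
  have := congr1 (fun t : 'X_{1..N} => t a) EA.
  by rewrite mnmDE mnmE (negPf aA) => /esym/eqP; rewrite addn_eq0 => /andP[].
have m01 a : (m a <= 1)%N.
  have := congr1 (fun t : 'X_{1..N} => t a) EA; rewrite mnmDE mnmE => Ea.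
  by rewrite (leq_trans (leq_addr (m' a) _)) // -Ea; case: (a \in A).
have Em1 : m = mesym1 (mnm_supp m).
  by apply/mnmP=> a; rewrite mnmE finset.inE; move: (m01 a); case: (m a) => [|[]].
have := ideal_supp_coeff Ip (faces_sub mA fA).
rewrite /supp_coeff (big_rem m) //= eqxx big_seq_cond big1 ?addr0.
  by apply/eqP; rewrite -mcoeff_msupp.
move=> t; rewrite mem_rem_uniq ?msupp_uniq // => /andP[/andP[t_m tp] /eqP Et].
have /existsP[a /andP[_]] := lead_m t tp t_m.
by rewrite Em1 -Et ltnNge (mnm_lepP (mesym1_supp_le t)).
Qed.

(** A monomial that is not squarefree leads its difference with its squarefree support, and a
    squarefree monomial on a nonface is itself in the ideal. *)
Lemma standard_monomial_mesym1 m :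
  standard_monomial s I m -> m = mesym1 (mnm_supp m) /\ mnm_supp m \in faces.
Proof.
have lead_notin p : p \in I -> is_lex_lead s p m -> ~~ standard_monomial s I m.
  by move=> Ip lead_p; rewrite negbK ideal_gen_sub //; exists p, m.
move=> std_m; have Em : m = mesym1 (mnm_supp m).
  apply/eqP; apply: contraLR std_m => m_neq.
  apply: lead_notin (mpolyX_supp m) _; split.
    rewrite mcoeff_msupp mcoeffB !mcoeffX eqxx [mesym1 _ == m]eq_sym.
    by rewrite (negPf m_neq) subr0 oner_eq0.
  move=> t; rewrite mcoeff_msupp mcoeffB !mcoeffX => t0 t_m.
  move: t0; rewrite [m == t]eq_sym (negPf t_m) sub0r oppr_eq0.
  case: (eqVneq (mesym1 (mnm_supp m)) t) => [<- _|_]; last by rewrite eqxx.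
  have : exists a, mesym1 (mnm_supp m) a != m a.
    apply/existsP; apply: contraNT m_neq => /existsPn Ea.
    by apply/eqP/mnmP=> a; apply/esym/eqP; rewrite -[_ == _]negbK.
  case=> a0 a0P.
  (* The differing variable of least rank decides the comparison. *)
  case: (@arg_minnP _ a0 (fun a => mesym1 (mnm_supp m) a != m a) (fun a => s a : nat) a0P).
  move=> a aP a_min.
  apply/existsP; exists a; rewrite ltn_neqAle aP.
  rewrite (mnm_lepP (mesym1_supp_le m)) !andbT.
  apply/forallP => a'; apply/implyP; rewrite ltnNge; apply: contraNT.
  exact: a_min.
split=> //; apply: contraLR std_m => nf.
apply: (lead_notin 'X_[m]); first by rewrite Em mpolyX_nonface.
split; first by rewrite msuppX finset.inE.
by move=> t; rewrite msuppX finset.inE => /eqP-> /eqP.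
Qed.

(** Taking supports is a bijection from standard monomials to faces that turns degree into
    cardinality. *)
Lemma HF_faces d : HF s I d = #|[set A in faces | #|A| == d]|.
Proof.
pose f (m : 'X_{1..N < d.+1}) := mnm_supp m.
rewrite /HF -(card_in_imset (f := f)); last first.
  move=> m1 m2; rewrite !finset.inE => /andP[_ /standard_monomial_mesym1[E1 _]].
  move=> /andP[_ /standard_monomial_mesym1[E2 _]] E.
  by apply: val_inj; rewrite /= E1 E2 -/(f m1) E.
apply: eq_card => A; rewrite [in RHS]finset.inE; apply/imsetP/andP => [[m]|[fA /eqP dA]].
  rewrite finset.inE => /andP[/eqP dm /standard_monomial_mesym1[Em fm]] ->.
  by rewrite /f; split=> //; rewrite -mdeg_mesym1 -Em dm.
have dAlt : (mdeg (mesym1 A : 'X_{1..N}) < d.+1)%N by rewrite mdeg_mesym1 dA.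
exists (BMultinom dAlt); last by rewrite /f /= mnm_supp_mesym1.
by rewrite finset.inE /= mdeg_mesym1 dA eqxx standard_monomial_face.
Qed.

End Lex.
End SquarefreeBooleanIdeal.

(** * Self-orthogonal arrays and the faces of their ideal *)

Section SelfOrthogonalArrays.
Variables r n : nat.
Implicit Types (P : 'M[option 'I_n]_r) (A : {set 'I_(nvars r n)}).
Implicit Types (i j : 'I_r) (k p q : 'I_n).

Notation faces := (faces (@so_generator r n)).

Definition var i j k : 'I_(nvars r n) := enum_rank ((i, j, k) : vidx r n).

Lemma var_surj a : exists i j k, a = var i j k.
Proof.
by case E: (enum_val a) => [[i j] k]; exists i, j, k; rewrite /var -E enum_valK.
Qed.

Lemma so_generator_bool a : @so_generator r n ('X_a * ('X_a - 1)).
Proof. by have [i [j [k ->]]] := var_surj a; apply: SoBool. Qed.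

Lemma so_generator_shape (g : {mpoly 'F_2[nvars r n]}) : so_generator g ->
  (exists a, g = 'X_a * ('X_a - 1)) \/ (exists m, g = 'X_[m]).
Proof.
by case=> [i j k|i i' j k _|i j j' k _|i j k k' _|i j k l p q _];
  [left; exists (var i j k) | right; rewrite /x -!mpolyXD; eexists..].
Qed.

Lemma meval_ind_x A i j k : (x i j k).@[ind _ A] = (var i j k \in A)%:R.
Proof. exact: mevalXU. Qed.

(** Each family of monomial generators forbids one pattern; index inequalities become plain
    distinctness because the products are symmetric. *)
Lemma so_facesP A : A \in faces <->
  [/\ forall i i' j k, var i j k \in A -> var i' j k \in A -> i = i',
      forall i j j' k, var i j k \in A -> var i j' k \in A -> j = j',
      forall i j k k', var i j k \in A -> var i j k' \in A -> k = k' &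
      forall i j i' j' p q, var i j p \in A -> var i' j' p \in A ->
        var j i q \in A -> var j' i' q \in A -> (i, j) = (i', j')].
Proof.
rewrite finset.in_set; split=> [/asboolP G0|[col row cell orth]].
  split=> [i i' j k Ai Ai'|i j j' k Aj Aj'|i j k k' Ak Ak'|
           i j i' j' p q A1 A2 A3 A4].
  - apply/eqP/negPn/negP; rewrite neq_ltn => /orP[] /(SoCol j k)/G0/eqP;
      by rewrite mevalM !meval_ind_x Ai Ai' mulr1 oner_eq0.
  - apply/eqP/negPn/negP; rewrite neq_ltn => /orP[] /(SoRow i k)/G0/eqP;
      by rewrite mevalM !meval_ind_x Aj Aj' mulr1 oner_eq0.
  - apply/eqP/negPn/negP; rewrite neq_ltn => /orP[] /(SoCell i j)/G0/eqP;
      by rewrite mevalM !meval_ind_x Ak Ak' mulr1 oner_eq0.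
  - apply/eqP/negPn/negP => /(SoOrth p q)/G0/eqP.
    by rewrite !mevalM !meval_ind_x A1 A2 A3 A4 !mulr1 oner_eq0.
apply/asboolP=> g.
case=> [i j k|i i' j k lt|i j j' k lt|i j k k' lt|i j i' j' p q].
- exact: ind_bool.
- rewrite mevalM !meval_ind_x; case: (boolP (var i j k \in A)); rewrite ?mul0r //.
  case: (boolP (var i' j k \in A)); rewrite ?mulr0 // => A1 A2.
  by rewrite (col _ _ _ _ A1 A2) ltnn in lt.
- rewrite mevalM !meval_ind_x; case: (boolP (var i j k \in A)); rewrite ?mul0r //.
  case: (boolP (var i j' k \in A)); rewrite ?mulr0 // => A1 A2.
  by rewrite (row _ _ _ _ A1 A2) ltnn in lt.
- rewrite mevalM !meval_ind_x; case: (boolP (var i j k \in A)); rewrite ?mul0r //.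
  case: (boolP (var i j k' \in A)); rewrite ?mulr0 // => A1 A2.
  by rewrite (cell _ _ _ _ A1 A2) ltnn in lt.
move=> neq; rewrite !mevalM !meval_ind_x -!natrM !mulnb.
case: (boolP (_ && _)) => // /andP[/andP[/andP[A1 A2] A3] A4].
by rewrite (orth _ _ _ _ _ _ A1 A2 A3 A4) eqxx in neq.
Qed.

(** The counterpart of [so_facesP] for arrays, where one symbol per cell is built into the entry
    type. *)
Lemma SORP P : P \in SOR r n <->
  [/\ forall i i' j k, P i j = Some k -> P i' j = Some k -> i = i',
      forall i j j' k, P i j = Some k -> P i j' = Some k -> j = j' &
      forall i j i' j' p q, P i j = Some p -> P i' j' = Some p ->
        P j i = Some q -> P j' i' = Some q -> (i, j) = (i', j')].
Proof.
rewrite finset.in_set; split.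
  case/andP=> /andP[/'forall_'forall_forallP row /'forall_'forall_forallP col].
  move=> /'forall_forallP orth.
  split=> [i i' j k P1 P2|i j j' k P1 P2|i j i' j' p q P1 P2 P3 P4].
  - by apply/eqP; have := col j i i'; rewrite P1 P2 eqxx andbT implybF negbK.
  - by apply/eqP; have := row i j j'; rewrite P1 P2 eqxx andbT implybF negbK.
  - apply/eqP; have := orth (i, j) (i', j').
    by rewrite /= !mxE P1 P2 P3 P4 !eqxx /= andbT implybF negbK.
case=> col row orth; apply/andP; split; first (apply/andP; split).
- apply/'forall_'forall_forallP=> i j j'; apply/implyP=> /andP[neq].
  case E: (P i j) => [k|//] _; apply: contraNneq neq => E'.
  by apply/eqP; apply: row E _.
- apply/'forall_'forall_forallP=> j i i'; apply/implyP=> /andP[neq].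
  case E: (P i j) => [k|//] _; apply: contraNneq neq => E'.
  by apply/eqP; apply: col E _.
apply/'forall_forallP=> -[i j] [i' j']; apply/implyP => /= /and3P[neq].
case E: (P i j) => [p|//] _ /eqP E'; apply: contraNN neq; rewrite !mxE.
case F: (P j i) => [q|//] /= /eqP F'; apply/eqP.
by apply: orth E _ F _.
Qed.

(** * Encoding arrays as sets of variables *)

Definition cells P : {set 'I_(nvars r n)} :=
  [set a | P (enum_val a).1.1 (enum_val a).1.2 == Some (enum_val a).2].

Lemma mem_cells P i j k : (var i j k \in cells P) = (P i j == Some k).
Proof. by rewrite finset.in_set enum_rankK. Qed.

Lemma cells_inj : injective cells.
Proof.
move=> P Q E; apply/matrixP=> i j.
have EPQ k : (P i j == Some k) = (Q i j == Some k) by rewrite -!mem_cells E.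
case: (P i j) (Q i j) EPQ => [k|] [k'|] // EPQ.
- by apply/eqP; rewrite eq_sym -EPQ.
- by have := EPQ k; rewrite eqxx.
- by have := EPQ k'; rewrite eqxx.
Qed.

Lemma cells_face P : (cells P \in faces) = (P \in SOR r n).
Proof.
apply/idP/idP => [/so_facesP[col row _ orth]|/SORP[col row orth]].
  apply/SORP; split=> [i i' j k|i j j' k|i j i' j' p q] /eqP + /eqP.
  - by rewrite -!mem_cells; apply: col.
  - by rewrite -!mem_cells; apply: row.
  - by rewrite -!mem_cells => A1 A2 /eqP + /eqP; rewrite -!mem_cells; apply: orth A1 A2.
apply/so_facesP; split=> [i i' j k|i j j' k|i j k k'|i j i' j' p q];
  rewrite !mem_cells => /eqP E1 /eqP E2.
- exact: col E1 E2.
- exact: row E1 E2.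
- by move: E2; rewrite E1 => -[].
- by move=> /eqP E3 /eqP; apply: orth E1 E2 E3.
Qed.

Lemma face_cells A : A \in faces -> exists2 P, P \in SOR r n & cells P = A.
Proof.
move=> fA; have /so_facesP[_ _ cell _] := fA.
(* By [cell] at most one [k] qualifies, so the choice is forced; without any, the cell stays
   empty. *)
pose P : 'M_r := \matrix_(i, j) [pick k | var i j k \in A].
have EA : cells P = A.
  apply/setP=> a; have [i [j [k ->]]] := var_surj a; rewrite mem_cells mxE.
  case: pickP => [k' Ak'|A0]; last by rewrite A0.
  by apply/eqP/idP => [[<-]//|Ak]; rewrite (cell _ _ _ _ Ak Ak').
by exists P; rewrite // -cells_face EA.
Qed.

(** Forgetting the symbol is injective on [cells P], and its image is the set of filled cells. *)
Lemma card_cells P : #|cells P| = psize P.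
Proof.
pose f (a : 'I_(nvars r n)) := (enum_val a).1.
rewrite /psize -(card_in_imset (f := f)) => [|a b]; last first.
  have [i [j [k ->]]] := var_surj a; have [i' [j' [k' ->]]] := var_surj b.
  rewrite !mem_cells /f !enum_rankK /= => /eqP E + [Ei Ej].
  by subst; rewrite E => /eqP[->].
apply: eq_card => -[i j]; rewrite [RHS]finset.in_set /=; apply/imsetP/idP.
  case=> a; have [i' [j' [k ->]]] := var_surj a.
  by rewrite mem_cells /f enum_rankK => /eqP E [-> ->]; rewrite E.
case E: (P i j) => [k|//] _; exists (var i j k); first by rewrite mem_cells E.
by rewrite /f enum_rankK.
Qed.

Lemma card_SOR : #|SOR r n| = #|faces|.
Proof.
rewrite -(card_imset _ cells_inj); apply: eq_card => A.
apply/imsetP/idP => [[P PS ->]|/face_cells[P PS <-]]; last by exists P.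
by rewrite cells_face.
Qed.

Lemma card_SORm m : #|SORm r n m| = #|[set A in faces | #|A| == m]|.
Proof.
rewrite -(card_imset _ cells_inj); apply: eq_card => A.
apply/imsetP/idP => [[P + ->]|].
  rewrite /SORm finset.in_set => /andP[PS Pm].
  by rewrite finset.in_set cells_face card_cells PS.
rewrite finset.in_set => /andP[/face_cells[P PS <-]].
by rewrite card_cells => Pm; exists P; rewrite // /SORm finset.in_set PS.
Qed.

(** * Common zeros and Krull dimension *)

Lemma point_of_ind P a : point_of P (enum_val a) = ind _ (cells P) a.
Proof. by rewrite ffunE /ind finset.in_set; case: ifP. Qed.

Lemma F2_cases (c : 'F_2) : c = 0 \/ c = 1.
Proof. by case: c => [[|[|]]] // ?; [left|right]; apply: val_inj. Qed.

Lemma point_of_bij :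
  set_bij [set P | P \in SOR r n]%classic (common_zeros (so_ideal r n))
          (@point_of r n).
Proof.
have evalE P (p : {mpoly 'F_2[nvars r n]}) : p.@[fun a => point_of P (enum_val a)] = p.@[ind _ (cells P)].
  by apply: meval_eq => a; apply: point_of_ind.
split.
- move=> P /= PS p Ip; rewrite evalE.
  by apply: ideal_vanish Ip _; rewrite cells_face.
- move=> P Q _ _ E; apply: cells_inj; apply/setP => a.
  have := point_of_ind P a; rewrite E point_of_ind /ind.
  by do 2 case: (_ \in _).
(* Over ['F_2] every point is the indicator of the set where it equals 1. *)
move=> y y0; pose A := [set a : 'I_(nvars r n) | y (enum_val a) == 1].
have yA (a : 'I_(nvars r n)) : y (enum_val a) = ind _ A a.
  by rewrite /ind finset.in_set; case: (F2_cases (y (enum_val a))) => ->.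
have /face_cells[P PS EP] : A \in faces.
  rewrite finset.in_set; apply/asboolP=> g Gg.
  by rewrite -(y0 g) ?ideal_gen_sub //; apply: meval_eq => a; rewrite yA.
exists P => //; apply/ffunP=> t.
by rewrite -[t]enum_rankK point_of_ind EP yA.
Qed.

Lemma so_ideal_zero_dimensional : zero_dimensional (so_ideal r n).
Proof.
have idem (p : {mpoly 'F_2[nvars r n]}) : p * (p - 1) \in so_ideal r n.
  apply: (vanish_ideal so_generator_bool so_generator_shape) => A _.
  rewrite mevalM mevalB meval1; case: (F2_cases p.@[ind _ A]) => ->.
    by rewrite mul0r.
  by rewrite subrr mulr0.
split.
  split; [exact: ideal_gen0| |exact: ideal_genMD].
  (* The empty array gives a common zero, so the ideal is proper. *)
  have empty_face : cells (const_mx None) \in faces.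
    by rewrite cells_face; apply/SORP; split=> i i' j j'; rewrite mxE.
  apply/negP => /ideal_vanish/(_ empty_face)/eqP.
  by rewrite meval1 oner_eq0.
move=> Q Qcl Qpr IQ; split=> // J [J0 J1 Jcl] QJ p Jp.
(* By primality [Q] contains [p] or [p - 1]; the latter would put 1 = p - (p - 1) into the proper
   ideal [J]. *)
case/orP: (Qpr _ _ (IQ _ (idem p))) => // /QJ Jp1; case/negP: J1.
by rewrite -(subKr p 1) addrC -mulN1r Jcl.
Qed.

End SelfOrthogonalArrays.

Theorem theorem3 (r n : nat) (hr : (0 < r)%N) (hn : (0 < n)%N) :
  [/\ zero_dimensional (so_ideal r n),
      set_bij [set P | P \in SOR r n]%classic
              (common_zeros (so_ideal r n)) (@point_of r n),
      has_quotient_dim (so_ideal r n) #|SOR r n|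
    & forall (s : {perm 'I_(nvars r n)}) (m : nat),
        #|SORm r n m| = HF s (so_ideal r n) m].
Proof.
split.
- exact: so_ideal_zero_dimensional.
- exact: point_of_bij.
- rewrite card_SOR.
  exact: (faces_quotient_dim (@so_generator_bool r n) (@so_generator_shape r n)).
- move=> s m; rewrite card_SORm.
  by rewrite (HF_faces (@so_generator_bool r n) (@so_generator_shape r n)).
Qed.
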